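(* Let $\alpha>-1$, $\beta\in\mathbb{R}$, $k^2\in(0,1)$, and let $\beta_n$ and $\mathsf{p}_1(n)$ be the recurrence coefficients and sub-leading coefficients of the monic polynomials orthogonal with respect to $w(x,k^2)=(1-x^2)^{\alpha}(1-k^2x^2)^{\beta}$ on $[-1,1]$. Then for every $n\ge2$, $$\beta_{n-1}C_{n-2}=\beta_nC_n+1,$$ where $$C_n:=2\big(\alpha+\beta+n+\tfrac32\big)k^2(\beta_n+\beta_{n+1})-2\Big[\big(\beta+n+\tfrac12\big)k^2+\big(\alpha+n+\tfrac12\big)\Big]-4k^2\mathsf{p}_1(n).$$ When $\alpha=\beta=-\tfrac12$ this reduces to Rees' equation $\beta_{n-1}C^{\rm Rees}_{n-2}=\beta_nC^{\rm Rees}_n+1$ with $C_n^{\rm Rees}:=(2n+1)k^2(\beta_n+\beta_{n+1})-2n(k^2+1)-4k^2\mathsf{p}_1(n)$.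
   Context: For $\alpha>-1$, $\beta\in\mathbb{R}$, $k^2\in(0,1)$, the weight is $w(x,k^2)=(1-x^2)^{\alpha}(1-k^2x^2)^{\beta}$, $x\in[-1,1]$. For $n\ge0$, $P_n$ is the monic polynomial of degree $n$ with $\int_{-1}^1 P_i(x)P_j(x)w(x,k^2)\,dx=h_j\delta_{i,j}$. As $w$ is even, $P_n(x)=x^n+\mathsf{p}_1(n)x^{n-2}+\dots+P_n(0)$, with $\mathsf{p}_1(0)=\mathsf{p}_1(1):=0$. The recurrence coefficients $\beta_n$ (with an index; $\beta$ without index is the exponent) are defined by $xP_n(x)=P_{n+1}(x)+\beta_nP_{n-1}(x)$, with $P_{-1}:=0$, $\beta_0:=0$; thus $\beta_n=h_n/h_{n-1}$ for $n\ge1$. *)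

(* Defs.v *)
From mathcomp Require Import all_boot all_order all_algebra.
From mathcomp Require Import all_classical all_reals all_analysis.

Set Implicit Arguments.
Unset Strict Implicit.
Unset Printing Implicit Defensive.

Import Order.TTheory GRing.Theory Num.Theory.
Import numFieldNormedType.Exports.

Local Open Scope classical_set_scope.
Local Open Scope ring_scope.

(* [powR] is total: for alpha < 0 the value at x = 1 and x = -1 is the junk
   value 0 ^ alpha = 0, on a Lebesgue-null set. *)
Definition weight (R : realType) (alpha beta k x : R) : R :=
  (1 - x ^+ 2) `^ alpha * (1 - k ^+ 2 * x ^+ 2) `^ beta.

(* The integrals are extended-real valued, so the equation also says that they
   are finite; [h j *+ (i == j)] is h_j times the Kronecker delta. *)
Definition monic_orthogonal (R : realType) (w : R -> R)
    (P : nat -> {poly R}) (h : nat -> R) : Prop :=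
  (forall n, P n \is monic /\ size (P n) = n.+1) /\
  (forall i j,
    (\int[lebesgue_measure]_(x in `[(-1)%R, 1%R])
       ((P i).[x] * (P j).[x] * w x)%:E)%E = (h j *+ (i == j))%:E).

(* P_{n-1}, with P_{-1} = 0. *)
Definition prev_poly (R : realType) (P : nat -> {poly R}) (n : nat) : {poly R} :=
  if n is m.+1 then P m else 0.

Definition recurrence_coef (R : realType)
    (P : nat -> {poly R}) (b : nat -> R) : Prop :=
  b 0%N = 0 /\ forall n, 'X * P n = P n.+1 + b n *: prev_poly P n.

Definition p1 (R : realType) (P : nat -> {poly R}) (n : nat) : R :=
  if n is m.+2 then (P n)`_m else 0.

Definition Ccoef (R : realType) (alpha beta k : R)
    (P : nat -> {poly R}) (b : nat -> R) (n : nat) : R :=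
  2 * (alpha + beta + n%:R + 3 / 2) * k ^+ 2 * (b n + b n.+1)
  - 2 * ((beta + n%:R + 1 / 2) * k ^+ 2 + (alpha + n%:R + 1 / 2))
  - 4 * k ^+ 2 * p1 P n.

Definition CRees (R : realType) (k : R)
    (P : nat -> {poly R}) (b : nat -> R) (n : nat) : R :=
  (2 * n%:R + 1) * k ^+ 2 * (b n + b n.+1)
  - 2 * n%:R * (k ^+ 2 + 1)
  - 4 * k ^+ 2 * p1 P n.

(* Main.v *)
Require Import Defs.
From mathcomp Require Import all_boot all_order all_algebra.
From mathcomp Require Import all_classical all_reals all_analysis.
From mathcomp Require Import measurable_realfun.
From mathcomp Require Import ring lra zify.

Import Order.TTheory GRing.Theory Num.Theory.
Import numFieldNormedType.Exports.
Local Open Scope classical_set_scope.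
Local Open Scope ring_scope.

(** Write L(p) for the integral of p w over [-1, 1].  With
    phi = (1 - x^2)(1 - k^2 x^2) the weight satisfies a Pearson equation
    (phi w)' = psi w, where psi is odd of degree at most 3.  Since
    alpha > -1, the function phi w q vanishes at both endpoints for every
    polynomial q, so that integrating its derivative gives

      L(phi q' + psi q) = 0                                   (P)

    ([weighted_integral_pearson]).  The rest is algebra of orthogonal
    polynomials ([laguerre_freud]): apply (P) to

      q = P_n (P_{n+1} - b_n P_{n-1}).

    For the usual choice q = P_n P_{n-1}, the integral of phi P_n' P_{n-1}
    involves the coefficient of x^(n-4) in P_n, and one would have to subtract
    two consecutive instances to eliminate it.  The combination above is
    already such a difference: since h_n = b_n h_{n-1}, it is h_n times
    P_{n+1} P_n / h_n - P_n P_{n-1} / h_{n-1}.  Differentiating the recurrence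
    gives

      q' = P_n^2 + 2 P_n' P_{n+1} - 2 b_n P_{n-1}' P_n,

    in which each derivative is multiplied by a polynomial of higher degree.
    Hence only the two top coefficients of the derivatives count:
    L(x^2 P_n' P_{n+1}) and L(x^4 P_n' P_{n+1}) are expressed by n, p1(n), the b_j and the h_j
    ([moment_deriv2], [moment_deriv4]), and (P) becomes
    h_n (1 + b_{n+1} C_{n+1} - b_n C_{n-1}) = 0.  Finally h_n is nonzero,
    because P_n^2 w is positive outside a finite set. *)

(** * Orthogonality with respect to a linear functional *)

(** Subtracting a multiple of [P n] lowers the degree; with a monic family
    containing one polynomial of each degree this drives every induction on
    the size below. *)
Lemma size_sub_lead (F : nzRingType) (P : nat -> {poly F}) (n : nat) (r : {poly F}) :
  P n \is monic /\ size (P n) = n.+1 ->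
  (size r <= n.+1)%N -> (size (r - r`_n *: P n)%R <= n)%N.
Proof.
move=> [/monicP Pmon Psz] rs; rewrite lead_coefE Psz /= in Pmon.
apply/leq_sizeP => j; rewrite coefB coefZ leq_eqVlt => /predU1P[<-|nj].
  by rewrite Pmon mulr1 subrr.
rewrite (nth_default _ (leq_trans rs nj)) (nth_default _ (_ : size (P n) <= j)%N).
  by rewrite mulr0 subrr.
by rewrite Psz.
Qed.

Lemma monic_basis_ind (F : nzRingType) (P : nat -> {poly F}) (K : {poly F} -> Prop) :
  (forall n, P n \is monic /\ size (P n) = n.+1) ->
  K 0 -> (forall c n p, K p -> K (c *: P n + p)) -> forall p, K p.
Proof.
move=> P_monic K0 KS p; have [n] := ubnP (size p).
elim: n p => [//|[|n] IH] p; rewrite ltnS => sp.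
  by move: sp; rewrite leqn0 size_poly_eq0 => /eqP ->.
rewrite -[p](subrKC (p`_n *: P n)); apply: KS; apply: IH.
by rewrite ltnS size_sub_lead.
Qed.

(** The polynomial (1 - x^2)(1 - k^2 x^2), expanded because the functional is
    evaluated one power of x at a time. *)
Definition pearson_phi (R : realType) (k : R) : {poly R} :=
  1 - (1 + k ^+ 2) *: 'X^2 + k ^+ 2 *: 'X^4.

(** The polynomial ((1 - x^2)(1 - k^2 x^2) w)' / w, where w is the weight with
    exponents alpha and beta. *)
Definition pearson_psi (R : realType) (alpha beta k : R) : {poly R} :=
  - (2 * (alpha + 1 + (beta + 1) * k ^+ 2)) *: 'X
  + (2 * k ^+ 2 * (alpha + beta + 2)) *: 'X^3.

Section OrthogonalMoments.
Context (R : realType) (L : {poly R} -> R).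
Context (P : nat -> {poly R}) (h b : nat -> R).
Hypothesis L_scalar : scalar L.
Hypothesis P_monic : forall n, P n \is monic /\ size (P n) = n.+1.
Hypothesis P_orth : forall i j, L (P i * P j) = h j *+ (i == j).
Hypothesis P_rec : recurrence_coef P b.

Lemma functional0 : L 0 = 0.
Proof.
have := L_scalar 1 0 0; rewrite scale1r addr0 mul1r => /eqP.
by rewrite -subr_eq0 opprD addNKr oppr_eq0 => /eqP.
Qed.

Lemma functionalD p q : L (p + q) = L p + L q.
Proof. by rewrite -[p]scale1r L_scalar mul1r scale1r. Qed.

Lemma functionalZ c p : L (c *: p) = c * L p.
Proof. by rewrite -[c *: p]addr0 L_scalar functional0 addr0. Qed.

Lemma functionalB p q : L (p - q) = L p - L q.
Proof. by rewrite functionalD -scaleN1r functionalZ mulN1r. Qed.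

Lemma functional_lower_size m (r : {poly R}) : (size r <= m)%N -> L (r * P m) = 0.
Proof.
suff H : forall s (r : {poly R}), (s <= m)%N -> (size r <= s)%N -> L (r * P m) = 0.
  exact: H.
elim=> [|s IH] {}r sm.
  by rewrite leqn0 size_poly_eq0 => /eqP ->; rewrite mul0r functional0.
move=> rs.
have -> : r * P m = (r - r`_s *: P s) * P m + r`_s *: (P s * P m).
  by rewrite mulrBl -scalerAl subrK.
rewrite functionalD functionalZ P_orth ltn_eqF// mulr0n mulr0 addr0.
by apply: IH; [exact: ltnW | exact: size_sub_lead].
Qed.

(** Against [P m], a polynomial of degree at most m is seen only through its
    coefficient of degree m. *)
Lemma functional_lead m (r : {poly R}) : (size r <= m.+1)%N -> L (r * P m) = r`_m * h m.
Proof.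
move=> rs.
have -> : r * P m = (r - r`_m *: P m) * P m + r`_m *: (P m * P m).
  by rewrite mulrBl -scalerAl subrK.
rewrite functionalD functionalZ P_orth eqxx mulr1n.
by rewrite functional_lower_size ?add0r ?size_sub_lead.
Qed.

Lemma coefP_top n : (P n)`_n = 1.
Proof. by have [/monicP + Psz] := P_monic n; rewrite lead_coefE Psz. Qed.

Lemma coefP_gt n j : (n < j)%N -> (P n)`_j = 0.
Proof. by move=> nj; rewrite nth_default// (P_monic n).2. Qed.

Lemma recS n : 'X * P n.+1 = P n.+2 + b n.+1 *: P n.
Proof. exact: P_rec.2. Qed.

(** The recurrence has no term in [P n], so each [P n] has the parity of n. *)
Lemma coefP_sub n : (P n.+1)`_n = 0.
Proof.
elim: n => [|n IH].
  have := congr1 (fun p : {poly R} => p`_0) (P_rec.2 0%N).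
  by rewrite /= scaler0 addr0 coefXM.
have := congr1 (fun p : {poly R} => p`_n.+1) (recS n).
by rewrite /= coefXM /= IH coefD coefZ (@coefP_gt n n.+1)// mulr0 addr0 => <-.
Qed.

Lemma p1S n : p1 P n.+1 = p1 P n - b n.
Proof.
case: n => [|n]; first by rewrite /= P_rec.1 subrr.
have := congr1 (fun p : {poly R} => p`_n) (recS n).
rewrite /= coefXM coefD coefZ coefP_top mulr1 => /eqP.
rewrite -subr_eq => /eqP <-; congr (_ - _).
by case: n => //= ; rewrite coefP_gt.
Qed.

(** The value of L(x P_n P_{n+1}) is h_{n+1} by the leading term of x P_n, and
    b_{n+1} h_n by the recurrence for x P_{n+1}. *)
Lemma normS n : h n.+1 = b n.+1 * h n.
Proof.
have : L (P n * P n.+2) = 0 by rewrite P_orth ltn_eqF.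
rewrite -[P n.+2](addrK (b n.+1 *: P n)) -recS mulrBr functionalB /=.
rewrite mulrA [_ * 'X]mulrC -scalerAr functionalZ /= P_orth eqxx mulr1n.
rewrite functional_lead; last first.
  by rewrite (leq_trans (size_polyMleq _ _))// size_polyX (P_monic n).2.
by rewrite coefXM /= coefP_top mul1r => /eqP; rewrite subr_eq0 => /eqP.
Qed.

(** Each moment below reduces to the preceding one by applying the recurrence
    to one factor x P_n.  The values are kept as combinations of several norms;
    [normS] finally turns them into multiples of a single one. *)
Lemma momentX1 n : L ('X * (P n.+1 * P n)) = h n.+1.
Proof.
rewrite mulrA recS mulrDl functionalD /= P_orth gtn_eqF// add0r -scalerAl functionalZ /=.
by rewrite P_orth eqxx mulr1n -normS.
Qed.

Lemma momentX2 n : L ('X^2 * (P n * P n)) = h n.+1 + b n * h n.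
Proof.
have -> : 'X^2 * (P n * P n) = 'X * P n * ('X * P n) by ring.
rewrite {1}P_rec.2 mulrDl functionalD /=; congr (_ + _).
  by rewrite -momentX1; congr (L _); ring.
case: n => [|n] /=; first by rewrite scaler0 mul0r functional0 P_rec.1 mul0r.
rewrite -scalerAl functionalZ /=; congr (_ * _).
by rewrite -momentX1; congr (L _); ring.
Qed.

Lemma momentX3 n :
  L ('X^3 * (P n.+1 * P n)) = h n.+2 + b n.+1 * (h n.+1 + b n * h n).
Proof.
have -> : 'X^3 * (P n.+1 * P n) = 'X * P n.+1 * ('X^2 * P n) by ring.
rewrite recS mulrDl functionalD /=; congr (_ + _).
  rewrite mulrC functional_lead.
    by rewrite coefXnM /= subSS subSS subn0 coefP_top mul1r.
  by rewrite (leq_trans (size_polyMleq _ _))// size_polyXn (P_monic n).2.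
rewrite -scalerAl functionalZ /=; congr (_ * _).
by rewrite -momentX2; congr (L _); ring.
Qed.

(** Stated for index n + 1 so that the previous polynomial is again a member
    of the family. *)
Lemma momentX4 n : L ('X^4 * (P n.+1 * P n.+1)) =
  h n.+3 + b n.+2 * (h n.+2 + b n.+1 * h n.+1)
  + b n.+1 * (h n.+2 + b n.+1 * (h n.+1 + b n * h n)).
Proof.
have -> : 'X^4 * (P n.+1 * P n.+1) = 'X * P n.+1 * ('X^3 * P n.+1) by ring.
rewrite recS mulrDl functionalD -scalerAl functionalZ /= -!momentX3; congr (_ + _ * _).
  by congr (L _); ring.
by congr (L _); ring.
Qed.

Lemma moment_deriv0 n : L ((P n)^`() * P n.+1) = 0.
Proof.
rewrite functional_lower_size//.
by rewrite (leq_trans (size_poly _ _))// (P_monic n).2.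
Qed.

(** The Euler operator x d/dx - n multiplies the coefficient of x^j by j - n:
    it removes the leading term of [P n], and by parity the degree drops by 2. *)
Lemma coef_euler n j : ('X * (P n)^`() - n%:R *: P n)`_j = (P n)`_j * (j%:R - n%:R).
Proof.
rewrite coefB coefXM coefZ coef_deriv; case: j => [|j] /=; first by ring.
by rewrite -mulr_natr; ring.
Qed.

Lemma size_euler n : (size ('X * (P n)^`() - n%:R *: P n)%R <= n.-1)%N.
Proof.
apply/leq_sizeP => j; rewrite coef_euler.
have [nj|jn] := ltnP n j; first by rewrite coefP_gt // mul0r.
have [-> _|jn'] := eqVneq j n; first by rewrite subrr mulr0.
case: n jn jn' => [|n] jn jn' /= nj; first by move: jn; rewrite leqn0 (negbTE jn').
have -> : j = n by lia.
by rewrite coefP_sub mul0r.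
Qed.

(** X P_n' and n P_n differ by a polynomial of degree n - 2, which remains
    orthogonal to [P n.+1] after multiplication by X. *)
Lemma moment_deriv2 n : L ('X^2 * ((P n)^`() * P n.+1)) = n%:R * h n.+1.
Proof.
rewrite -momentX1 -functionalZ /=.
apply/eqP; rewrite -subr_eq0 -functionalB /=; apply/eqP.
have -> : 'X^2 * ((P n)^`() * P n.+1) - n%:R *: ('X * (P n.+1 * P n))
  = ('X * ('X * (P n)^`() - n%:R *: P n)) * P n.+1.
  by rewrite -!mul_polyC; ring.
rewrite functional_lower_size// (leq_trans (size_polyMleq _ _))// size_polyX.
by have := size_euler n; lia.
Qed.

(** Here the difference X P_n' - n P_n is multiplied by X^3, hence reaches degree
    n + 1 and contributes its top coefficient -2 p1(n): this is where the
    sub-leading coefficient enters the equation. *)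
Lemma moment_deriv4 n : L ('X^4 * ((P n)^`() * P n.+1)) =
  n%:R * (h n.+2 + b n.+1 * (h n.+1 + b n * h n)) - 2 * p1 P n * h n.+1.
Proof.
rewrite -momentX3 -functionalZ /=.
have -> : 'X^4 * ((P n)^`() * P n.+1) = n%:R *: ('X^3 * (P n.+1 * P n))
  + ('X^3 * ('X * (P n)^`() - n%:R *: P n)) * P n.+1.
  by rewrite -!mul_polyC; ring.
rewrite functionalD /=; congr (_ + _).
have size_shift : (size ('X^3 * ('X * (P n)^`() - n%:R *: P n))%R <= n.+2)%N.
  case: n => [|n]; last first.
    rewrite (leq_trans (size_polyMleq _ _))// size_polyXn.
    by have := size_euler n.+1; lia.
  have := size_euler 0%N; rewrite leqn0 size_poly_eq0 => /eqP ->.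
  by rewrite mulr0 size_poly0.
rewrite functional_lead// coefXnM coef_euler.
clear size_shift; case: n => [|[|n]] /=; rewrite ?mulr0 ?mul0r ?oppr0 //.
rewrite subSS subSS subSS subn0 -mulNr; congr (_ * _).
by rewrite -addn2 natrD; ring.
Qed.

Hypothesis h_neq0 : forall n, h n != 0.
Context (alpha beta k : R).

(** The Pearson relation for P_n (P_{n+1} - b_n P_{n-1}) with n = m + 1: every
    term of its expansion is one of the moments computed above. *)
Lemma laguerre_freud m :
  (forall q, L (pearson_phi R k * q^`() + pearson_psi R alpha beta k * q) = 0) ->
  b m.+1 * Ccoef alpha beta k P b m = b m.+2 * Ccoef alpha beta k P b m.+2 + 1.
Proof.
move=> pearson.
have phi_expand u : L (pearson_phi R k * u) =
    L u - (1 + k ^+ 2) * L ('X^2 * u) + k ^+ 2 * L ('X^4 * u).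
  rewrite -!functionalZ -functionalB -functionalD; congr (L _).
  by rewrite /pearson_phi -!mul_polyC; ring.
have psi_expand u : L (pearson_psi R alpha beta k * u) =
    - (2 * (alpha + 1 + (beta + 1) * k ^+ 2)) * L ('X * u)
    + (2 * k ^+ 2 * (alpha + beta + 2)) * L ('X^3 * u).
  rewrite -!functionalZ -functionalD; congr (L _).
  by rewrite /pearson_psi -!mul_polyC; ring.
have := pearson (P m.+1 * (P m.+2 - b m.+1 *: P m)).
have -> : (P m.+1 * (P m.+2 - b m.+1 *: P m))^`() =
    2 *: ((P m.+1)^`() * P m.+2) + P m.+1 * P m.+1
    - (2 * b m.+1) *: ((P m)^`() * P m.+1).
  (* Once P_{n+1} is eliminated from both sides, the identity is one between
     polynomials in x, P_n, P_{n-1} and the derivatives of these two. *)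
  have E : P m.+2 = 'X * P m.+1 - b m.+1 *: P m by rewrite recS addrK.
  rewrite derivM derivB derivZ [in RHS]E {2}E derivB derivZ derivM derivX {1}E.
  by rewrite -!mul_polyC; ring.
set phi := pearson_phi R k in phi_expand *.
set psi := pearson_psi R alpha beta k in psi_expand *.
have -> : phi * (2 *: ((P m.+1)^`() * P m.+2) + P m.+1 * P m.+1
      - (2 * b m.+1) *: ((P m)^`() * P m.+1))
      + psi * (P m.+1 * (P m.+2 - b m.+1 *: P m))
  = 2 *: (phi * ((P m.+1)^`() * P m.+2)) + phi * (P m.+1 * P m.+1)
    - (2 * b m.+1) *: (phi * ((P m)^`() * P m.+1))
    + psi * (P m.+2 * P m.+1) - b m.+1 *: (psi * (P m.+1 * P m)).
  by rewrite -!mul_polyC; ring.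
rewrite !(functionalB, functionalD, functionalZ) !phi_expand !psi_expand.
rewrite !moment_deriv0 !moment_deriv2 !moment_deriv4.
rewrite momentX4 !momentX3 momentX2 !momentX1.
rewrite P_orth eqxx mulr1n !p1S !normS => E.
(* [E] says that h (m + 1) times the difference of the two sides vanishes. *)
apply: (mulfI (h_neq0 m.+1)); apply/esym/subr0_eq.
by rewrite -[RHS]E /Ccoef !p1S !normS -!natr1; field.
Qed.

End OrthogonalMoments.

(** * Integration of derivatives that are unbounded at the endpoints *)

(** An integral that is a real number cannot hide a difference of infinities,
    since [+oo - oo] is [-oo]. *)
Lemma integral_fin_integrable d (T : measurableType d) (R : realType)
    (mu : {measure set T -> \bar R}) (D : set T) (f : T -> \bar R) (r : R) :
  measurable D -> measurable_fun D f -> (\int[mu]_(x in D) f x = r%:E)%E ->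
  mu.-integrable D f.
Proof.
move=> mD mf intf; apply/integrableP; split => //.
have [posoo negoo] : (\int[mu]_(x in D) f^\+ x < +oo /\ \int[mu]_(x in D) f^\- x < +oo)%E.
  move: intf; rewrite integralE.
  have : (0 <= \int[mu]_(x in D) f^\+ x)%E by apply: integral_ge0.
  have : (0 <= \int[mu]_(x in D) f^\- x)%E by apply: integral_ge0.
  by case: (integral mu D f^\-)%E => [a| |]; case: (integral mu D f^\+)%E => [c| |];
    rewrite ?ltry.
rewrite (eq_integral (fun x => f^\+ x + f^\- x)%E); last first.
  by move=> x _; have := congr1 (@^~ x) (fune_abse f).
rewrite ge0_integralD//.
- exact: lte_add_pinfty.
- exact: measurable_funepos.
- exact: measurable_funeneg.
Qed.

(** The fundamental theorem of calculus for an integrable derivative that is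
    continuous in the open interval only.  The indefinite integral G of f is
    continuous on the closed interval and has derivative f inside, hence F - G
    is constant by the mean value theorem. *)
Lemma Rintegral_derivative (R : realType) (a c : R) (F f : R -> R) :
  a < c ->
  (@lebesgue_measure R).-integrable `[a, c] (EFin \o f) ->
  {in `]a, c[, continuous f} ->
  {within `[a, c], continuous F} ->
  (forall x, x \in `]a, c[ -> is_derive x (1 : R) F (f x)) ->
  (\int[lebesgue_measure]_(x in `[a, c]) f x = F c - F a)%R.
Proof.
move=> ac intf contf contF dF.
pose G x := (\int[lebesgue_measure]_(t in `[a, x]) f t)%R.
have contG : {within `[a, c], continuous G}.
  exact: parameterized_integral_continuous (ltW ac) intf.
have dG x : x \in `]a, c[ -> is_derive x (1 : R) G (f x).
  move=> xac; have /andP[ax xc] : a < x < c by move: xac; rewrite in_itv.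
  have [dGx Gx] := continuous_FTC1_closed xc intf ax (contf _ xac).
  by split => //; rewrite -derive1E.
have dFG x : x \in `]a, c[ -> is_derive x (1 : R) (F - G) ((fun=> 0) x).
  move=> xac; have := dF _ xac; have := dG _ xac => dGx dFx.
  by apply: (trigger_derive (is_deriveB dFx dGx)); rewrite subrr.
have contFG : {within `[a, c], continuous (F - G)}.
  by move=> x; apply: cvgB; [exact: contF | exact: contG].
have [x _] := MVT ac dFG contFG.
rewrite mul0r !fctE.
have Ga : G a = 0 by rewrite /G set_itv1 Rintegral_set1.
rewrite Ga -/(G c) => E; lra.
Qed.

Lemma derivable_continuous (R : realType) (f : R -> R) (x df : R) :
  is_derive x (1 : R) f df -> {for x, continuous f}.
Proof. by move=> dfx; apply/differentiable_continuous/derivable1_diffP. Qed.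

(** At a negative base [powR] takes the value 1, so the power function is
    continuous at 0 only after composition with the absolute value. *)
Lemma continuous0_norm_powR (R : realType) (a : R) : 0 < a ->
  `|y| `^ a @[y --> (0 : R)] --> (0 : R).
Proof.
move=> a0; apply/cvgrPdist_lt => e e0; near=> y.
rewrite sub0r normrN ger0_norm ?powR_ge0//.
have -> : e = (e `^ a^-1) `^ a by rewrite -powRrM mulVf ?gt_eqF// powRr1// ltW.
apply: gt0_ltr_powR; rewrite ?nnegrE ?powR_ge0//.
near: y; exact: (@nbhs0_lt R R _ (powR_gt0 _ e0)).
Unshelve. all: by end_near. Qed.

Lemma finite_set_roots (F : idomainType) (p : {poly F}) :
  p != 0 -> finite_set [set x | root p x].
Proof.
elim: {p}(size p) {-2}p (erefl (size p)) => [|n IH] p sp p0.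
  by move: p0; rewrite -size_poly_eq0 sp.
have [[a /= ra]|noroot] := pselect (exists a, root p a); last first.
  rewrite (_ : [set x | root p x] = set0) ?finite_set0//.
  by apply/seteqP; split => // x rx; case: noroot; exists x.
have /factor_theorem[q pq] := ra.
have q0 : q != 0 by apply: contraNneq p0 => q0; rewrite pq q0 mul0r.
have sq : size q = n.
  by move: sp; rewrite pq size_Mmonic// ?monicXsubC// size_XsubC addn2 /= => -[].
apply: (@sub_finite_set _ _ ([set x | root q x] `|` [set a])).
  by move=> x /=; rewrite pq rootM root_XsubC => /orP[|/eqP]; [left|right].
by rewrite finite_setU; split; [exact: IH | exact: finite_set1].
Qed.

(** * The weight and its Pearson equation *)

Section Weight.
Context (R : realType) (alpha beta k : R).
Hypothesis k_lt1 : k ^+ 2 < 1.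

Lemma factor1_gt0 (x : R) : x \in `]-1, 1[ -> 0 < 1 - x ^+ 2.
Proof. by rewrite in_itv /= => /andP[? ?]; nra. Qed.

Lemma factor2_gt0 (x : R) : x \in `[-1, 1] -> 0 < 1 - k ^+ 2 * x ^+ 2.
Proof.
rewrite in_itv /= => /andP[x1 x2].
have x21 : 0 <= 1 - x ^+ 2.
  by rewrite -(expr1n _ 2) subr_sqr mulr_ge0//; lra.
by have := mulr_ge0 (sqr_ge0 k) x21; rewrite mulrBr mulr1; move: k_lt1; lra.
Qed.

(** The factor 1 makes both bases instances of 1 - c x^2, the shape
    differentiated in [is_derive_factor]. *)
Lemma weightE : weight alpha beta k =
  fun x => (1 - 1 * x ^+ 2) `^ alpha * (1 - k ^+ 2 * x ^+ 2) `^ beta.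
Proof. by apply/funext => x; rewrite mul1r. Qed.

Lemma weight_gt0 (x : R) : x \in `]-1, 1[ -> 0 < weight alpha beta k x.
Proof.
move=> xI; apply: mulr_gt0; apply: powR_gt0; first exact: factor1_gt0.
by apply: factor2_gt0; exact: subset_itv_oo_cc.
Qed.

Lemma measurable_weight (D : set R) : measurable_fun D (weight alpha beta k).
Proof.
apply: (measurable_funS measurableT) => //; rewrite weightE.
have mfactor c a : measurable_fun [set: R] (fun x : R => (1 - c * x ^+ 2) `^ a).
  have -> : (fun x : R => (1 - c * x ^+ 2) `^ a)
          = (@powR R ^~ a) \o horner (1 - c *: 'X^2).
    by apply/funext => x; rewrite /= !hornerE.
  by apply: measurableT_comp; [exact: measurable_powR | exact: measurable_poly].
by apply: measurable_funM; exact: mfactor.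
Qed.

Lemma is_derive_factor (a c : R) (x : R) : 0 < 1 - c * x ^+ 2 ->
  is_derive x (1 : R) (fun y => (1 - c * y ^+ 2) `^ a)
    (a * (1 - c * x ^+ 2) `^ (a - 1) * (- (2 * c * x))).
Proof.
move=> x0; pose p : {poly R} := 1 - c *: 'X^2.
have px y : p.[y] = 1 - c * y ^+ 2 by rewrite /p !hornerE.
have Ep : (fun y => (1 - c * y ^+ 2) `^ a) = (@powR R ^~ a) \o horner p.
  by apply/funext => y /=; rewrite px.
rewrite Ep; rewrite -px in x0 *.
have dp := is_derive1_comp (is_derive1_powR a x0) (is_derive_poly p x).
apply: (trigger_derive dp).
by rewrite px /p derivB derivZ derivXn derivC !hornerE; ring.
Qed.

Lemma continuous_weight (x : R) : x \in `]-1, 1[ ->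
  {for x, continuous (weight alpha beta k)}.
Proof.
move=> xI; rewrite weightE.
have x1 : 0 < 1 - 1 * x ^+ 2 by rewrite mul1r; exact: factor1_gt0.
have x2 : 0 < 1 - k ^+ 2 * x ^+ 2.
  by apply: factor2_gt0; exact: subset_itv_oo_cc.
apply: cvgM.
- exact: (derivable_continuous _ _ _ _ (is_derive_factor alpha _ _ x1)).
- exact: (derivable_continuous _ _ _ _ (is_derive_factor beta _ _ x2)).
Qed.

End Weight.

Section Pearson.
Context (R : realType) (alpha beta k : R).
Hypothesis alpha_gtN1 : -1 < alpha.
Hypothesis k_lt1 : k ^+ 2 < 1.

(** The product phi w q of the Pearson equation: multiplying the weight by phi
    raises both exponents by 1. *)
Definition pearson_primitive (q : {poly R}) (x : R) : R :=
  weight (alpha + 1) (beta + 1) k x * q.[x].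

Lemma is_derive_pearson_primitive (q : {poly R}) (x : R) : x \in `]-1, 1[ ->
  is_derive x (1 : R) (pearson_primitive q)
    ((pearson_phi R k * q^`() + pearson_psi R alpha beta k * q).[x]
     * weight alpha beta k x).
Proof.
move=> xI; rewrite /pearson_primitive weightE.
have x1 := factor1_gt0 _ _ xI; rewrite -[x ^+ 2]mul1r in x1.
have x2 : 0 < 1 - k ^+ 2 * x ^+ 2.
  by apply: factor2_gt0 => //; exact: subset_itv_oo_cc.
have d1 := is_derive_factor _ (alpha + 1) _ _ x1.
have d2 := is_derive_factor _ (beta + 1) _ _ x2.
apply: (trigger_derive (is_deriveM (is_deriveM d1 d2) (is_derive_poly q x))).
have powS (y a : R) : 0 < y -> y `^ (a + 1) = y `^ a * y.
  by move=> y0; rewrite powRD ?powRr1 ?ltW// (gt_eqF y0) implybT.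
have -> : (pearson_phi R k * q^`() + pearson_psi R alpha beta k * q).[x] =
    (1 - x ^+ 2) * (1 - k ^+ 2 * x ^+ 2) * q^`().[x]
    - 2 * x * ((alpha + 1) * (1 - k ^+ 2 * x ^+ 2)
               + (beta + 1) * k ^+ 2 * (1 - x ^+ 2)) * q.[x].
  rewrite /pearson_phi /pearson_psi.
  rewrite !(hornerD, hornerM, hornerN, hornerZ, hornerXn, hornerX, hornerC).
  by ring.
rewrite /GRing.scale /= !fctE mul1r in x1 *.
by rewrite !addrK !powS// /weight; ring.
Qed.

Lemma pearson_primitive_endpoint (q : {poly R}) (x : R) :
  x ^+ 2 = 1 -> pearson_primitive q x = 0.
Proof.
move=> x1; rewrite /pearson_primitive /weight x1 subrr powR0 ?mul0r//.
by rewrite gt_eqF//; move: alpha_gtN1; lra.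
Qed.

(** The absolute value changes nothing inside the interval and turns the
    one-sided limit at an endpoint into a two-sided one; the exponent alpha + 1
    is positive, which makes the first factor tend to 0. *)
Lemma pearson_primitive_cvg_endpoint (q : {poly R}) (c : R) : c ^+ 2 = 1 ->
  `|1 - x ^+ 2| `^ (alpha + 1) * (1 - k ^+ 2 * x ^+ 2) `^ (beta + 1) * q.[x]
    @[x --> c] --> (0 : R).
Proof.
move=> c1.
rewrite (_ : 0 = 0 * (1 - k ^+ 2 * c ^+ 2) `^ (beta + 1) * q.[c]); last first.
  by rewrite !mul0r.
apply: cvgM; last exact: continuous_horner.
apply: cvgM.
  have a1 : 0 < alpha + 1 by move: alpha_gtN1; lra.
  apply: (cvg_comp _ (fun y : R => `|y| `^ (alpha + 1)) _
    (continuous0_norm_powR R _ a1)).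
  have E : 0 = (1 - 'X^2 : {poly R}).[c] by rewrite !hornerE c1 subrr.
  have Ef : (fun x : R => 1 - x ^+ 2) = horner (1 - 'X^2).
    by apply/funext => x; rewrite !hornerE.
  have := @continuous_horner R (1 - 'X^2) c.
  by rewrite /continuous_at -E -Ef.
have c0 : 0 < 1 - k ^+ 2 * c ^+ 2 by rewrite c1 mulr1 subr_gt0.
exact: (derivable_continuous _ _ _ _ (is_derive_factor R (beta + 1) _ _ c0)).
Qed.

Lemma continuous_pearson_primitive (q : {poly R}) :
  {within `[-1, 1], continuous (pearson_primitive q)}.
Proof.
have endpoint (c : R) : c ^+ 2 = 1 -> forall F : set_system R, Filter F ->
    F --> c -> (\forall x \near F, x \in `]-1, 1[) ->
    pearson_primitive q x @[x --> F] --> pearson_primitive q c.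
  move=> c1 F FF Fc nearF; rewrite pearson_primitive_endpoint//.
  apply: cvg_trans.
    2: exact: (cvg_comp _ _ Fc (pearson_primitive_cvg_endpoint q _ c1)).
  apply: near_eq_cvg; near=> x; rewrite /= /pearson_primitive /weight ger0_norm// ltW//.
  by apply: factor1_gt0; near: x.
apply/continuous_within_itvP; first lra.
split => [x xI||].
- exact: (derivable_continuous _ _ _ _ (is_derive_pearson_primitive q _ xI)).
- apply: endpoint; [by rewrite sqrrN expr1n | exact: cvg_within |].
  near=> x; rewrite in_itv /=; apply/andP; split; near: x.
    exact: nbhs_right_gt.
  by apply: nbhs_right_lt; lra.
- apply: endpoint; [by rewrite expr1n | exact: cvg_within |].
  near=> x; rewrite in_itv /=; apply/andP; split; near: x.
    by apply: nbhs_left_gt; lra.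
  exact: nbhs_left_lt.
Unshelve. all: by end_near. Qed.

End Pearson.

(** * The orthogonality functional of the weight *)

Section OrthogonalWeight.
Context (R : realType) (alpha beta k : R).
Hypothesis alpha_gtN1 : -1 < alpha.
Hypothesis k_lt1 : k ^+ 2 < 1.
Context (P : nat -> {poly R}) (h : nat -> R).

Local Notation w := (weight alpha beta k).
Hypothesis orthP : monic_orthogonal w P h.

Local Notation mu := (@lebesgue_measure R).
Local Notation D := (`[(-1)%R, 1%R]%classic : set R).

Definition weighted_integral (p : {poly R}) : R :=
  (\int[lebesgue_measure]_(x in `[(-1)%R, 1%R]) (p.[x] * weight alpha beta k x))%R.

Lemma measurable_weighted (p : {poly R}) : measurable_fun D (fun x => p.[x] * w x).
Proof. by apply: measurable_funM; [exact: measurable_poly | exact: measurable_weight]. Qed.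

(** The orthogonality relations against P_0 = 1 say that the integrals of the
    P_n w are real numbers, and the P_n span all polynomials. *)
Lemma integrable_weighted (p : {poly R}) :
  mu.-integrable D (EFin \o (fun x => p.[x] * w x)).
Proof.
apply: (monic_basis_ind _ P
  (fun p => mu.-integrable D (EFin \o (fun x => p.[x] * w x))) orthP.1)
  => [|c n {}p IH].
  apply: (eq_integrable _ (fun _ : measurableTypeR R => 0%E)).
  - exact: measurable_itv.
  - by move=> x _; rewrite /= horner0 mul0r.
  - exact: integrable0.
apply: (eq_integrable _ (fun x : measurableTypeR R =>
  (c%:E * ((P n).[x] * w x)%:E + (p.[x] * w x)%:E)%E)).
  exact: measurable_itv.
  by move=> x _; rewrite /= -EFinM -EFinD hornerD hornerZ mulrDl mulrA.
apply: integrableD; [exact: measurable_itv| |exact: IH].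
apply: integrableZl; first exact: measurable_itv.
apply: (integral_fin_integrable _ _ _ _ _ _ (h 0%N *+ (n == 0%N))).
  exact: measurable_itv.
  by apply/measurable_EFinP; exact: measurable_weighted.
rewrite -(orthP.2 n 0%N); apply: eq_integral => x _.
have P0 : P 0%N = 1.
  have [P0mon P0sz] := orthP.1 0%N.
  by move/monicP: P0mon; rewrite (size1_polyC (eq_leq P0sz)) lead_coefC => ->.
by rewrite P0 hornerC mulr1.
Qed.

Lemma weighted_integral_scalar : scalar weighted_integral.
Proof.
move=> c p q; rewrite /weighted_integral -RintegralZl//; last exact: integrable_weighted.
rewrite -RintegralD//; last exact: integrable_weighted; last first.
  by apply: (integrableZl _ c (integrable_weighted p)); exact: measurable_itv.
by apply: eq_Rintegral => x _; rewrite hornerD hornerZ; ring.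
Qed.

Lemma weighted_integral_orth i j : weighted_integral (P i * P j) = h j *+ (i == j).
Proof.
rewrite /weighted_integral /Rintegral -[RHS]/(fine (_%:E)) -orthP.2.
by congr fine; apply: eq_integral => x _; rewrite hornerM.
Qed.

Lemma weighted_integral_pearson (q : {poly R}) :
  weighted_integral (pearson_phi R k * q^`() + pearson_psi R alpha beta k * q) = 0.
Proof.
apply: (@etrans _ _ (pearson_primitive R alpha beta k q 1
                   - pearson_primitive R alpha beta k q (-1))).
  2: by rewrite !pearson_primitive_endpoint ?subrr// ?sqrrN expr1n.
apply: Rintegral_derivative.
- lra.
- exact: integrable_weighted.
- move=> x xI; apply: cvgM; first exact: continuous_horner.
  exact: continuous_weight.
- exact: continuous_pearson_primitive.
- move=> x xI; exact: is_derive_pearson_primitive.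
Qed.

(** If the integral of the nonnegative function p^2 w vanishes, then so does
    p^2 w almost everywhere, and the open interval is covered by a null set and
    the finitely many roots of p. *)
Lemma weighted_integral_sqr_neq0 (p : {poly R}) :
  p != 0 -> weighted_integral (p * p) != 0.
Proof.
move=> p0; apply/eqP => int0.
have : (\int[mu]_(x in D) `|((p * p).[x] * w x)%:E| = 0)%E.
  apply: (@etrans _ _ (\int[mu]_(x in D) ((p * p).[x] * w x)%:E)%E).
    apply: eq_integral => x _; rewrite abse_EFin ger0_norm// hornerM.
    by apply: mulr_ge0; [rewrite -expr2 sqr_ge0 | rewrite mulr_ge0 ?powR_ge0].
  rewrite -[LHS]fineK; last first.
    by apply: (integrable_fin_num _ (integrable_weighted (p * p))); exact: measurable_itv.
  by congr EFin.
move/ae_eq_integral_abs.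
have mD : measurable D by exact: measurable_itv.
have mf : measurable_fun D (fun x => ((p * p).[x] * w x)%:E).
  by apply/measurable_EFinP; exact: measurable_weighted.
move=> /(_ mD mf) ae0.
suff nI : mu.-negligible (`]-1, 1[ : set R).
  have : mu `](-1 : R), 1[ = 0%E by apply/negligibleP => //; exact: measurable_itv.
  rewrite lebesgue_measure_itv /= lte_fin ifT; last by lra.
  by case; lra.
have cover : `]-1, 1[ `<=`
    ~` [set x | D x -> ((p * p).[x] * w x)%:E = 0%E] `|` [set x | root p x].
  move=> x /= xI; have [rx|nrx] := boolP (root p x); [by right | left].
  apply/not_implyP; split; first exact: subset_itv_oo_cc.
  have wx : w x != 0 by rewrite gt_eqF//; exact: (weight_gt0 _ alpha beta _ k_lt1).
  case=> /eqP; rewrite hornerM mulf_eq0 (negbTE wx) orbF mulf_eq0 orbb.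
  exact/negP.
apply: (@negligibleS _ (measurableTypeR R) _ mu _ _ cover).
apply: negligibleU; first exact: ae0.
apply/negligibleP; last first.
  by apply: countable_lebesgue_measure0; apply: finite_set_countable; exact: finite_set_roots.
rewrite (_ : [set x | root p x] = setT `&` horner p @^-1` [set 0]).
  by apply: measurable_poly.
by apply/seteqP; split => x /=; rewrite rootE; [move/eqP | move=> [_ ->]].
Qed.

End OrthogonalWeight.

Theorem theorem1p3 (R : realType) (alpha beta k : R)
    (P : nat -> {poly R}) (h b : nat -> R)
    (halpha : -1 < alpha) (hk : 0 < k ^+ 2 < 1)
    (hP : monic_orthogonal (weight alpha beta k) P h)
    (hb : recurrence_coef P b) :
  let C := Ccoef alpha beta k P b in
  let C' := CRees k P b in
  (forall n : nat, (2 <= n)%N -> b (n - 1)%N * C (n - 2)%N = b n * C n + 1) /\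
  (alpha = - (1 / 2) -> beta = - (1 / 2) ->
    (forall n : nat, C n = C' n) /\
    (forall n : nat, (2 <= n)%N ->
       b (n - 1)%N * C' (n - 2)%N = b n * C' n + 1)).
Proof.
have /andP[_ k_lt1] := hk.
set L := weighted_integral R alpha beta k.
have orth i j : L (P i * P j) = h j *+ (i == j).
  exact: (weighted_integral_orth _ _ _ _ _ _ hP).
have h_neq0 n : h n != 0.
  have <- : L (P n * P n) = h n by rewrite orth eqxx.
  apply: (weighted_integral_sqr_neq0 _ _ _ _ k_lt1 _ _ hP).
  exact: monic_neq0 (hP.1 n).1.
move=> C C'.
have main n : (2 <= n)%N -> b (n - 1)%N * C (n - 2)%N = b n * C n + 1.
  case: n => [|[|m]]// _; rewrite subSS subn0 subSS subSS subn0.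
  apply: (laguerre_freud R L P h b) => //.
  - exact: (weighted_integral_scalar _ _ _ _ _ _ hP).
  - exact: hP.1.
  - exact: (weighted_integral_pearson _ _ _ _ halpha k_lt1 _ _ hP).
split=> [//|alphaE betaE].
have CE n : C n = C' n.
  by rewrite /C /C' /Ccoef /CRees alphaE betaE; field.
by split=> // n n2; rewrite -!CE; exact: main.
Qed.
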